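(* For every $d\in\mathbb{N}$, $$K_G^{\mathbb{R}}(2d)\;\le\;\sqrt{2}\,K_G^{\mathbb{C}}(d).$$
   Context: $\mathbb{N}=\{1,2,3,\dots\}$. For $\mathbb{F}\in\{\mathbb{R},\mathbb{C}\}$ and $d\in\mathbb{N}$, let $\mathbb{F}^d$ carry its standard inner product $\langle\cdot,\cdot\rangle$ and Euclidean norm, with unit sphere $\mathbb{S}^{d-1}=\{w\in\mathbb{F}^d:\|w\|_2=1\}$. The constant $K_G^{\mathbb{F}}(d)$ is the smallest constant $K>0$ such that $$\Big|\sum_{i=1}^m\sum_{j=1}^n a_{ij}\langle u_i,v_j\rangle\Big|\le K\,\sup\Big\{\Big|\sum_{i=1}^m\sum_{j=1}^n a_{ij}p_iq_j\Big| : p_i,q_j\in\mathbb{F},\ |p_i|=1=|q_j|\ \forall i,j\Big\}$$ for all $m,n\in\mathbb{N}$, all $m\times n$ matrices $(a_{ij})$ with entries in $\mathbb{F}$, and all $u_1,\dots,u_m,v_1,\dots,v_n\in\mathbb{S}^{d-1}\subset\mathbb{F}^d$. (Such a finite constant exists.) *)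

(* Defs.v *)
From mathcomp Require Import all_boot all_order all_algebra.
From mathcomp Require Import classical_sets reals.
From mathcomp Require Import complex.

Set Implicit Arguments.
Unset Strict Implicit.
Unset Printing Implicit Defensive.

Import Order.TTheory GRing.Theory Num.Theory.
Local Open Scope ring_scope.
Local Open Scope classical_set_scope.

(* The scalar field F is given together with its conjugation [conj] and its
   modulus [abs], valued in R because suprema are taken there: the norm
   of the numDomainType R[i] is valued in R[i]. *)
Section Grothendieck.
Variables (R : realType) (F : nzRingType) (conj : F -> F) (abs : F -> R).

Definition inner d (x y : 'rV[F]_d) : F := \sum_(k < d) x 0 k * conj (y 0 k).

Definition enorm d (x : 'rV[F]_d) : R := Num.sqrt (\sum_(k < d) abs (x 0 k) ^+ 2).

(* A nonempty subset of R, bounded above by the sum of the moduli of the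
   entries of a, so that its [sup] is the true supremum. *)
Definition unimodular_values m n (a : 'M[F]_(m, n)) : set R :=
  [set r | exists (p : 'I_m -> F) (q : 'I_n -> F),
     [/\ forall i, abs (p i) = 1, forall j, abs (q j) = 1
       & r = abs (\sum_(i < m) \sum_(j < n) a i j * p i * q j)]].

Definition grothendieck_bound d (K : R) : Prop :=
  0 < K /\
  forall (m n : nat), (0 < m)%N -> (0 < n)%N ->
  forall (a : 'M[F]_(m, n)) (u : 'I_m -> 'rV[F]_d) (v : 'I_n -> 'rV[F]_d),
  (forall i, enorm (u i) = 1) -> (forall j, enorm (v j) = 1) ->
  abs (\sum_(i < m) \sum_(j < n) a i j * inner (u i) (v j))
    <= K * sup (unimodular_values a).

(* For 0 < d and both instances below, this set is nonempty, has 1 as a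
   lower bound (take m = n = 1) and is closed under infima, so its [inf] is its least element. *)
Definition grothendieck_const d : R := inf [set K | grothendieck_bound d K].

End Grothendieck.

Definition KG_real (R : realType) (d : nat) : R :=
  @grothendieck_const R R id (fun x => `|x|) d.

Definition KG_complex (R : realType) (d : nat) : R :=
  @grothendieck_const R R[i] conjc (@ComplexField.Normc.normc R) d.

(* Main.v *)
Require Import Defs.
From mathcomp Require Import all_boot all_order all_algebra.
From mathcomp Require Import classical_sets reals topology normedtype derive trigo.
From mathcomp Require Import complex.
From mathcomp Require Import ring lra zify.

Set Implicit Arguments.
Unset Strict Implicit.
Unset Printing Implicit Defensive.

Import Order.TTheory GRing.Theory Num.Theory.
Import numFieldNormedType.Exports.
Import ComplexField.Normc.
Local Open Scope ring_scope.

(** Identify R^(2d) with C^d by [complexify], which keeps norms and turns the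
    real inner product into the real part of the complex one. A complex bound
    [K] then controls the real form by [K] times the complex unimodular supremum
    of the real matrix, and it remains to see that, for a real matrix, replacing
    the signs by complex numbers of modulus one increases the supremum by a
    factor of at most sqrt 2 ([complexified_value_le]). After a rotation this
    says: if every sign sum of [a] is at most [B], then
    sum a_ij cos (al_i - be_j) <= sqrt 2 * B ([angle_sum_le]).

    A kernel Phi (al - be) that is a combination, with nonnegative weights of
    total mass mu, of products of a sign depending on al and a sign depending on
    be satisfies sum a_ij Phi (al_i - be_j) <= mu * B. Correlating a square wave
    with itself gives the triangular wave, whose value at pi/4 is half of its
    maximum. Smear it with the weight cos 2u on |u| <= pi/4. Since the triangular
    wave is affine on [0, pi], the value at pi/4 is still half of the mass:
    Phi (pi/4) = mu / 2. The expansion is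
    Phi s = sum over odd n > 0 of c_n cos (n s), where c_n is the product of a
    squared Fourier coefficient of the square wave and of the transform of the
    weight. The latter is a positive multiple of - cos (n pi/4) / (n^2 - 4), so
    c_n cos (n pi/4) is nonnegative for n = 1 and nonpositive for every other odd
    n; its absolute value is |c_n| / sqrt 2. Let M be the supremum of the sums
    sum a_ij cos (al_i - be_j) over all angles. Multiplying all angles by n shows
    that the sums of a_ij cos (n (al_i - be_j)) are bounded by M as well. Hence
    c_1 M <= mu B + sum_(n > 1) |c_n| M, whereas
    c_1 - sum_(n > 1) |c_n| = sqrt 2 * Phi (pi/4) = mu / sqrt 2.
    Together, M <= sqrt 2 * B.

    The argument is carried out for angles in (pi / H) Z with H = 4 L, where the
    Fourier analysis consists of finite sums over the odd frequencies modulo 2 H;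
    the sign rule holds there without error term ([kernel_coef_sign]), so the
    constant on each grid is already sqrt 2 ([grid_sum_le]), and the grids are
    dense. Frequencies 1 and 2 H - 1 give the same cosine on the grid, so both
    play the role of n = 1.

    The infimum that defines a constant is only controlled by individual bounds
    when at least one exists, which [complex_bound_exists] provides. *)

(** * Square waves and their autocorrelation *)

Lemma cosD_natpi (R : realType) (m : nat) (z : R) :
  cos (z + m%:R * pi) = (-1) ^+ m * cos z.
Proof.
elim: m => [|m IH]; first by rewrite mul0r addr0 expr0 mul1r.
by rewrite -natr1 mulrDl mul1r addrA cosDpi IH exprS mulN1r mulNr.
Qed.

Lemma sinD_natpi (R : realType) (m : nat) (z : R) :
  sin (z + m%:R * pi) = (-1) ^+ m * sin z.
Proof.
elim: m => [|m IH]; first by rewrite mul0r addr0 expr0 mul1r.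
by rewrite -natr1 mulrDl mul1r addrA sinDpi IH exprS mulN1r mulNr.
Qed.

(** Multiplication by 2 sin (x / 2) makes a sum of cosines in arithmetic
    progression telescope. *)
Lemma sin_halfM_sum_cos (R : realType) (n : nat) (x c : R) :
  2 * sin (x / 2) * (\sum_(k < n) cos (k%:R * x + c)) =
  sin (n%:R * x + c - x / 2) - sin (c - x / 2).
Proof.
elim: n => [|n IH]; first by rewrite big_ord0 mul0r add0r mulr0 subrr.
rewrite big_ord_recr /= mulrDr IH.
have -> : n.+1%:R * x + c - x / 2 = n%:R * x + c + x / 2.
  by rewrite -natr1; field.
rewrite (sinB (n%:R * x + c)) (sinD (n%:R * x + c)); ring.
Qed.

(** Sampled at H points per half period; increasing [m] by [H] changes the sign. *)
Definition square_wave (R : realType) (H m : nat) : R := (-1) ^+ (m %/ H).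

Lemma square_wave_norm (R : realType) (H m : nat) : `|square_wave R H m| = 1.
Proof. by rewrite /square_wave normrX normrN1 expr1n. Qed.

Lemma square_wave_small (R : realType) (H m : nat) :
  (m < H)%N -> square_wave R H m = 1.
Proof. by move=> lt_mH; rewrite /square_wave divn_small. Qed.

Lemma square_waveDH (R : realType) (H m : nat) : (0 < H)%N ->
  square_wave R H (m + H) = - square_wave R H m.
Proof. by move=> H0; rewrite /square_wave divnDr // divnn H0 addn1 exprS mulN1r. Qed.

Lemma sum_window_shift (R : realType) (H : nat) (F : nat -> R) (q : nat) :
  (forall k, F (k + H)%N = F k) ->
  \sum_(t < H) F (q + t)%N = \sum_(t < H) F t.
Proof.
move=> perF; elim: q => [//|q IH]; rewrite -{}IH.
case: H perF => [|H] perF; first by rewrite !big_ord0.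
rewrite big_ord_recr [RHS]big_ord_recl /= addrC; congr (_ + _).
  by rewrite addn0 addSnnS perF.
by apply: eq_bigr => i _; rewrite addSnnS.
Qed.

Lemma cos_oddD_half (R : realType) (H j : nat) (z : R) : (0 < H)%N ->
  cos (j.*2.+1%:R * (pi / H%:R) * (z + H%:R)) =
  - cos (j.*2.+1%:R * (pi / H%:R) * z).
Proof.
move=> H0; have H0' : H%:R != 0 :> R by rewrite pnatr_eq0 -lt0n.
rewrite mulrDr -[X in _ + X]mulrA divfK // cosD_natpi.
by rewrite exprS -mul2n exprM sqrrN !expr1n mulr1 mulN1r.
Qed.

(** Orthogonality of the characters that change sign under a shift by [H]: these
    are the ones of odd frequency. *)
Lemma sum_cos_odd_eq0 (R : realType) (H m l : nat) :
  (m < H)%N -> (l < H)%N -> m != l ->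
  \sum_(j < H) cos (j.*2.+1%:R * (pi / H%:R) * (m%:R - l%:R)) = 0 :> R.
Proof.
wlog lt_lm : m l / (l < m)%N => [W lt_m lt_l|].
  rewrite neq_ltn => /orP[lt|lt]; last first.
    by apply: W => //; rewrite neq_ltn lt orbT.
  rewrite -[RHS](W _ _ lt lt_l lt_m); last by rewrite neq_ltn lt orbT.
  by apply: eq_bigr => j _; rewrite -cosN -mulrN opprB.
move=> lt_m lt_l _; have H0 : 0 < H%:R :> R by rewrite ltr0n; lia.
have Hn0 := lt0r_neq0 H0.
set x : R := pi / H%:R * (m%:R - l%:R).
have x0 : 0 < x.
  by rewrite mulr_gt0 ?divr_gt0 ?pi_gt0 // subr_gt0 ltr_nat.
have xpi : x < pi.
  rewrite /x mulrAC ltr_pdivrMr // ltr_pM2l ?pi_gt0 //.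
  by rewrite ltrBlDr -natrD ltr_nat; lia.
have s0 : 2 * sin (x *+ 2 / 2) != 0.
  rewrite (_ : x *+ 2 / 2 = x); last by field.
  rewrite mulf_neq0 ?pnatr_eq0 //.
  by apply/lt0r_neq0/sin_gt0_pi/andP.
apply: (mulfI s0); rewrite mulr0.
under eq_bigr => j _.
  rewrite (_ : _ * _ = j%:R * (x *+ 2) + x); last first.
    by rewrite -natr1 -mul2n natrM /x; ring.
  over.
rewrite sin_halfM_sum_cos.
rewrite (_ : H%:R * (x *+ 2) + x - x *+ 2 / 2 = 0 + ((2 * (m - l))%N%:R * pi)); last first.
  by rewrite natrM natrB 1?ltnW // /x; field.
rewrite (_ : x - _ = 0); last by field.
by rewrite sinD_natpi sin0 mulr0 subrr.
Qed.

(** Only odd frequencies occur because the wave changes sign under a shift by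
    [H]. The sum over [l] is the discrete transform of the wave, which equals 1
    on [0, H). *)
Lemma square_wave_fourier (R : realType) (H m : nat) : (0 < H)%N ->
  H%:R * square_wave R H m =
  \sum_(j < H) \sum_(l < H) cos (j.*2.+1%:R * (pi / H%:R) * (m%:R - l%:R)).
Proof.
move=> H0; elim/ltn_ind: m => m IH.
have [lt_mH|le_Hm] := ltnP m H.
  rewrite exchange_big /= (bigD1 (Ordinal lt_mH)) //= [X in _ + X]big1 ?addr0.
    rewrite square_wave_small // mulr1 (eq_bigr (fun=> 1)); last first.
      by move=> j _; rewrite subrr mulr0 cos0.
    by rewrite sumr_const card_ord.
  by move=> l ne; apply: sum_cos_odd_eq0; rewrite // eq_sym.
rewrite -(subnK le_Hm) square_waveDH // mulrN IH; last by lia.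
rewrite -sumrN; apply: eq_bigr => j _; rewrite -sumrN; apply: eq_bigr => l _.
by rewrite natrD addrAC cos_oddD_half.
Qed.

Definition wave_corr (R : realType) (H p q : nat) : R :=
  \sum_(t < H) square_wave R H (p + t) * square_wave R H (q + t).

(** Squared modulus of the Fourier coefficient of the square wave at the odd
    frequency 2 j + 1. *)
Definition wave_power (R : realType) (H j : nat) : R :=
  (\sum_(t < H) cos (j.*2.+1%:R * (pi / H%:R) * t%:R)) ^+ 2 +
  (\sum_(t < H) sin (j.*2.+1%:R * (pi / H%:R) * t%:R)) ^+ 2.

Lemma wave_power_ge0 (R : realType) (H j : nat) : 0 <= wave_power R H j.
Proof. by rewrite addr_ge0 ?sqr_ge0. Qed.

(** The sine terms cancel by antisymmetry in [l] and [t], which leaves the squared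
    modulus of sum_t exp (i x t). *)
Lemma sum2_cos_sub (R : realType) (n : nat) (x c : R) :
  \sum_(l < n) \sum_(t < n) cos (x * t%:R - x * l%:R + c) =
  ((\sum_(t < n) cos (x * t%:R)) ^+ 2 + (\sum_(t < n) sin (x * t%:R)) ^+ 2)
   * cos c.
Proof.
set X := \sum_(t < n) cos _; set Y := \sum_(t < n) sin _.
under eq_bigr => l _.
  rewrite (_ : \sum_(t < n) _ =
    cos (x * l%:R) * (X * cos c - Y * sin c)
    + sin (x * l%:R) * (Y * cos c + X * sin c)); last first.
    rewrite /X /Y !mulr_suml -sumrN -!big_split /= !mulr_sumr -big_split /=.
    by apply: eq_bigr => t _; rewrite cosD cosB sinB; ring.
  over.
rewrite big_split /= -!mulr_suml -/X -/Y; ring.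
Qed.

Lemma wave_corr_fourier (R : realType) (H p q : nat) : (0 < H)%N ->
  H%:R * wave_corr R H p q =
  \sum_(j < H) wave_power R H j * cos (j.*2.+1%:R * (pi / H%:R) * (p%:R - q%:R)).
Proof.
move=> H0; rewrite /wave_corr mulr_sumr.
under eq_bigr => t _ do
  rewrite mulrA square_wave_fourier // mulr_suml.
rewrite exchange_big /=; apply: eq_bigr => j _.
under eq_bigr => t _ do rewrite mulr_suml.
rewrite exchange_big /= -sum2_cos_sub.
apply: eq_bigr => l _.
set y : R := j.*2.+1%:R * (pi / H%:R).
(* Both factors change sign under a shift by H, so the window of summation
   can be moved to [0, H), where the wave equals 1. *)
pose F (k : nat) : R := cos (y * (k%:R - q%:R + p%:R - l%:R)) * square_wave R H k.
have perF k : F (k + H)%N = F k.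
  rewrite /F square_waveDH // natrD.
  rewrite (_ : k%:R + H%:R - q%:R + p%:R - l%:R = (k%:R - q%:R + p%:R - l%:R) + H%:R); last by ring.
  by rewrite cos_oddD_half // mulrNN.
rewrite (eq_bigr (fun t : 'I_H => F (q + t)%N)); last first.
  by move=> t _; rewrite /F !natrD; congr (cos (_ * _) * _); ring.
rewrite sum_window_shift //; apply: eq_bigr => t _.
by rewrite /F square_wave_small // mulr1; congr cos; ring.
Qed.

(** The triangular wave: each unit of shift moves one more sample across a sign
    change. *)
Lemma wave_corrE (R : realType) (H q m : nat) : (m <= H)%N ->
  wave_corr R H (q + m) q = H%:R - (2 * m)%:R.
Proof.
case: (posnP H) => [->|H0]; first by case: m => // _; rewrite /wave_corr big_ord0 subrr.
move=> le_mH; rewrite /wave_corr.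
pose F k := square_wave R H (k + m) * square_wave R H k.
rewrite (eq_bigr (fun t : 'I_H => F (q + t)%N)); last first.
  by move=> t _; rewrite /F addnAC.
rewrite sum_window_shift; last first.
  by move=> k; rewrite /F addnAC !square_waveDH // mulrNN.
rewrite (eq_bigr (fun t : 'I_H => square_wave R H (m + t)))%N; last first.
  by move=> t _; rewrite /F (square_wave_small R (ltn_ord t)) mulr1 addnC.
elim: m le_mH {F} => [|m IH] lt_mH.
  rewrite (eq_bigr (fun=> 1)); last first.
    by move=> t _; rewrite add0n square_wave_small.
  by rewrite sumr_const card_ord subr0.
have := IH (ltnW lt_mH).
case: H H0 lt_mH {IH} => // H _ lt_mH.
rewrite big_ord_recl big_ord_recr /= addn0 square_wave_small //.
rewrite addSnnS square_waveDH // square_wave_small //.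
under [X in _ = _ -> X + _ = _]eq_bigr => t _ do rewrite addSnnS.
move=> E; rewrite mulnS natrD; lra.
Qed.

(** * The transform of the weight cos 2u *)

(** The weight cos 2u for |u| <= pi/4, with the argument moved by pi/4 so that [k]
    ranges over [0, 2 L]; see [humpE]. *)
Definition hump (R : realType) (L k : nat) : R :=
  sin (2 * (pi / (4 * L)%:R) * k%:R).

(** Transform of the weight at frequency [nu]; the weight is even, so cosines
    suffice. *)
Definition hump_hat (R : realType) (L : nat) (nu : R) : R :=
  \sum_(k < (2 * L).+1) hump R L k * cos (nu * (pi / (4 * L)%:R) * (L%:R - k%:R)).

Lemma humpE (R : realType) (L k : nat) : (0 < L)%N ->
  hump R L k = cos (2 * (pi / (4 * L)%:R) * (k%:R - L%:R)).
Proof.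
move=> L0; have L0' : L%:R != 0 :> R by rewrite pnatr_eq0 -lt0n.
rewrite mulrBr natrM (_ : 2 * (pi / (4 * L%:R)) * L%:R = pi / 2); last by field.
by rewrite cosBpihalf /hump natrM.
Qed.

Lemma hump_ge0 (R : realType) (L k : nat) : (k <= 2 * L)%N -> 0 <= hump R L k.
Proof.
case: (posnP L) => [->|L0 le_k].
  by rewrite muln0 leqn0 => /eqP->; rewrite /hump mulr0 sin0.
have L0' : 0 < L%:R :> R by rewrite ltr0n.
apply: sin_ge0_pi; apply/andP; split.
  by rewrite !mulr_ge0 ?invr_ge0 ?pi_ge0 ?ler0n.
rewrite natrM (_ : _ * _ = pi * k%:R / (2 * L%:R)); last first.
  by field; rewrite lt0r_neq0.
rewrite ler_pdivrMr ?mulr_gt0 // ler_wpM2l ?pi_ge0 //.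
by rewrite -natrM ler_nat.
Qed.

Lemma hump_rev (R : realType) (L k : nat) : (0 < L)%N -> (k <= 2 * L)%N ->
  hump R L (2 * L - k) = hump R L k.
Proof.
move=> L0 le_k; rewrite !humpE // natrB // natrM.
by rewrite -cosN; congr cos; ring.
Qed.

Lemma sum_hump_gt0 (R : realType) (L : nat) : (0 < L)%N ->
  0 < \sum_(k < (2 * L).+1) hump R L k.
Proof.
move=> L0; have ltL : (L < (2 * L).+1)%N by lia.
rewrite (bigD1 (Ordinal ltL)) //= ltr_pwDl //.
  by rewrite humpE // subrr mulr0 cos0.
by apply: sumr_ge0 => k _; apply: hump_ge0; rewrite -ltnS.
Qed.

Lemma sum_hump_rev (R : realType) (L : nat) (F : R -> R) : (0 < L)%N ->
  \sum_(k < (2 * L).+1) hump R L k * F (L%:R - k%:R) =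
  \sum_(k < (2 * L).+1) hump R L k * F (k%:R - L%:R).
Proof.
move=> L0; rewrite (reindex_inj rev_ord_inj) /=; apply: eq_bigr => k _.
have le_k : (k <= 2 * L)%N by rewrite -ltnS.
rewrite subSS hump_rev // natrB // natrM; congr (_ * F _); ring.
Qed.

Lemma sum_hump_cos (R : realType) (L : nat) (nu D : R) : (0 < L)%N ->
  \sum_(k < (2 * L).+1)
     hump R L k * cos (nu * (pi / (4 * L)%:R) * (D + (L%:R - k%:R))) =
  hump_hat L nu * cos (nu * (pi / (4 * L)%:R) * D).
Proof.
move=> L0; set y := nu * _.
have E := sum_hump_rev (fun z => cos (y * (D + z))) L0.
apply: (@mulfI _ 2); first by rewrite pnatr_eq0.
rewrite mulrDl mul1r {2}E -big_split /= /hump_hat -/y mulr_suml mulr_sumr.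
apply: eq_bigr => k _; rewrite -(opprB L%:R k%:R); move: (L%:R - k%:R) => z.
rewrite -mulrDr (_ : cos (y * (D + z)) + cos (y * (D - z)) =
  2 * (cos (y * z) * cos (y * D))); last by rewrite mulrDr mulrBr cosD cosB; ring.
ring.
Qed.

(** Writing the product of cosines as a sum gives two Dirichlet kernels, at nu + 2
    and nu - 2. Their end terms sit at angle pi/4, where the weight vanishes, and
    combine so that the transform becomes
    cos (nu pi/4) (cot a - cot b) / 2 with a = (nu + 2) th / 2,
    b = (nu - 2) th / 2 and th = pi / (4 L). The denominators are cleared here. *)
Lemma sin_hump_hat (R : realType) (L : nat) (nu : R) : (0 < L)%N ->
  2 * (sin ((nu + 2) * (pi / (4 * L)%:R) / 2) * sin ((nu - 2) * (pi / (4 * L)%:R) / 2))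
    * hump_hat L nu =
  - (cos (nu * (pi / 4)) * sin (2 * (pi / (4 * L)%:R))).
Proof.
move=> L0; have L0' : L%:R != 0 :> R by rewrite pnatr_eq0 -lt0n.
set th := pi / (4 * L)%:R; have thL : th * L%:R = pi / 4.
  by rewrite /th natrM; field.
pose S x := \sum_(k < (2 * L).+1) cos (k%:R * (x * th) - L%:R * (x * th)).
have hatE : 2 * hump_hat L nu = S (nu + 2) + S (nu - 2).
  rewrite /hump_hat -/th mulr_sumr -big_split; apply: eq_bigr => k _ /=.
  rewrite humpE // -/th.
  rewrite (_ : k%:R * ((nu + 2) * th) - _ = nu * th * (k%:R - L%:R) + 2 * th * (k%:R - L%:R)); last by ring.
  rewrite (_ : k%:R * ((nu - 2) * th) - _ = nu * th * (k%:R - L%:R) - 2 * th * (k%:R - L%:R)); last by ring.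
  rewrite -(opprB k%:R) mulrN cosN cosD cosB; ring.
have SE x : sin (x * th / 2) * S x = sin (x * (pi / 4) + x * th / 2).
  have := sin_halfM_sum_cos (2 * L).+1 (x * th) (- (L%:R * (x * th))).
  rewrite -/(S x) (_ : (2 * L).+1%:R * (x * th) + _ - _ =
    x * (pi / 4) + x * th / 2); last by rewrite -thL -natr1 natrM; field.
  rewrite (_ : - _ - _ = - (x * (pi / 4) + x * th / 2)); last first.
    by rewrite -thL; ring.
  by rewrite sinN => E; lra.
set a := (nu + 2) * th / 2; set b := (nu - 2) * th / 2.
transitivity (sin b * (sin a * S (nu + 2)) + sin a * (sin b * S (nu - 2))).
  by rewrite -mulrA mulrCA hatE; ring.
rewrite !SE -/a -/b.
rewrite (_ : (nu + 2) * (pi / 4) + a = nu * (pi / 4) + a + pi / 2); last by field.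
rewrite (_ : (nu - 2) * (pi / 4) + b = nu * (pi / 4) + b - pi / 2); last by field.
rewrite sinDpihalf sinBpihalf !cosD.
rewrite (_ : 2 * th = a - b); last by rewrite /a /b; field.
rewrite sinB; ring.
Qed.

(** * Signs of the coefficients of the smeared kernel *)

(** The indices of the odd frequencies 1 and 8 L - 1, which are opposite modulo
    8 L. *)
Definition first_freq (L j : nat) : bool := (j == 0%N) || (j == (4 * L).-1).

(** Up to the factor 4 L, the Fourier coefficient of [kernel] at frequency 2 j + 1. *)
Definition kernel_coef (R : realType) (L j : nat) : R :=
  wave_power R (4 * L) j * hump_hat L j.*2.+1%:R.

(** The triangular wave smeared with the weight, as a function of [p - q] on the
    grid: a nonnegative combination of products of a sign depending on [p] and a
    sign depending on [q]. The shift by [L] centres the weight at 0. *)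
Definition kernel (R : realType) (L p q : nat) : R :=
  \sum_(k < (2 * L).+1) hump R L k * wave_corr R (4 * L) (p + L) (q + k).

Lemma kernel_fourier (R : realType) (L p q : nat) : (0 < L)%N ->
  (4 * L)%:R * kernel R L p q =
  \sum_(j < 4 * L) kernel_coef R L j *
    cos (j.*2.+1%:R * (pi / (4 * L)%:R) * (p%:R - q%:R)).
Proof.
move=> L0; rewrite /kernel mulr_sumr.
under eq_bigr => k _ do rewrite mulrCA wave_corr_fourier ?muln_gt0 // mulr_sumr.
rewrite exchange_big /=; apply: eq_bigr => j _.
rewrite /kernel_coef -mulrA -sum_hump_cos // mulr_sumr; apply: eq_bigr => k _.
rewrite mulrCA !natrD; congr (_ * (_ * cos (_ * _))); ring.
Qed.

(** At distance pi/4 the weight only sees an affine piece of the triangular wave,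
    and it is even, so it acts as if it were concentrated at its centre. *)
Lemma kernel_quarter (R : realType) (L q : nat) : (0 < L)%N ->
  kernel R L (q + L) q = (2 * L)%:R * \sum_(k < (2 * L).+1) hump R L k.
Proof.
move=> L0; rewrite /kernel mulr_sumr.
rewrite (eq_bigr (fun k : 'I__ => hump R L k * (2 * k%:R))); last first.
  move=> k _; have le_k : (k <= 2 * L)%N by rewrite -ltnS.
  rewrite (_ : q + L + L = q + k + (2 * L - k))%N; last by lia.
  rewrite wave_corrE; last by lia.
  congr (_ * _); rewrite -natrM -natrB; last by lia.
  by congr _%:R; lia.
have /eqP := sum_hump_rev (fun z : R => z) L0.
rewrite -subr_eq0 -sumrB => /eqP E.
apply/eqP; rewrite eq_sym -subr_eq0 -[X in _ == X]E -sumrB; apply/eqP.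
by apply: eq_bigr => k _; rewrite natrM; ring.
Qed.

(** The frequency 2 H - 1 is -1 modulo 2 H. *)
Lemma cos_top_freq (R : realType) (H p q : nat) : (0 < H)%N ->
  cos (H.-1.*2.+1%:R * (pi / H%:R) * (p%:R - q%:R)) =
  cos (pi / H%:R * (p%:R - q%:R)) :> R.
Proof.
case: H => // H _ /=; have H0 : H.+1%:R != 0 :> R by rewrite pnatr_eq0.
have ev k z : cos (z + (2 * k)%:R * pi) = cos z :> R.
  by rewrite cosD_natpi exprM sqrrN !expr1n mul1r.
rewrite -(ev q (pi / _ * _)) -(cosN (_ + _)) -(ev p (- _)); congr cos.
have E : H.*2.+1%:R = 2 * H.+1%:R - 1 :> R by rewrite -mul2n -!natr1 natrM; ring.
by rewrite E !natrM; field; rewrite addrC natr1.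
Qed.

Lemma cos_odd_quarter_sqr (R : realType) (j : nat) :
  cos (j.*2.+1%:R * (pi / 4)) ^+ 2 = 1 / 2 :> R.
Proof.
set x : R := _ * _; have := cos_mulr2n x.
have -> : x *+ 2 = pi / 2 + j%:R * pi.
  by rewrite /x -[X in X * _]natr1 -mul2n natrM; field.
rewrite cosD_natpi cos_pihalf mulr0 => E; lra.
Qed.

Lemma norm_cos_odd_quarter (R : realType) (j : nat) :
  `|cos (j.*2.+1%:R * (pi / 4))| = Num.sqrt 2 / 2 :> R.
Proof.
apply/eqP; rewrite -(@eqrXn2 _ 2) ?normr_ge0 ?divr_ge0 ?sqrtr_ge0 //.
rewrite -normrX cos_odd_quarter_sqr exprMn sqr_sqrtr ?ler0n // ger0_norm.
  by apply/eqP; field.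
by rewrite divr_ge0.
Qed.

Lemma cos_pi4 (R : realType) : cos (pi / 4) = Num.sqrt 2 / 2 :> R.
Proof.
rewrite -(norm_cos_odd_quarter R 0) mul1r ger0_norm // ltW //.
by apply: cos_gt0_pihalf; have := pi_gt0 R; lra.
Qed.

Lemma cos_end_quarter (R : realType) (L j : nat) : (0 < L)%N ->
  first_freq L j ->
  cos (j.*2.+1%:R * (pi / 4)) = Num.sqrt 2 / 2 :> R.
Proof.
move=> L0 /orP[]/eqP->; first by rewrite mul1r cos_pi4.
have L0' : L%:R != 0 :> R by rewrite pnatr_eq0 -lt0n.
have := @cos_top_freq R (4 * L) L 0; rewrite muln_gt0 L0 => /(_ isT).
rewrite subr0 -mulrA (_ : pi / (4 * L)%:R * L%:R = pi / 4); last by rewrite natrM; field.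
by rewrite cos_pi4.
Qed.

(** By [sin_hump_hat] the sign is opposite to that of sin a * sin b. Both angles lie
    in (0, pi) except at the two ends: for frequency 1 the angle b is negative, for
    frequency 8 L - 1 the angle a exceeds pi. *)
Lemma kernel_coef_sign (R : realType) (L j : nat) : (0 < L)%N -> (j < 4 * L)%N ->
  if first_freq L j
  then 0 <= kernel_coef R L j * cos (j.*2.+1%:R * (pi / 4))
  else kernel_coef R L j * cos (j.*2.+1%:R * (pi / 4)) <= 0.
Proof.
move=> L0 ltj.
have H0 : 0 < (4 * L)%:R :> R by rewrite ltr0n; lia.
have L1 : 1 <= L%:R :> R by rewrite ler1n.
set th : R := pi / (4 * L)%:R.
have th0 : 0 < th by rewrite divr_gt0 ?pi_gt0.
have thE : 4 * L%:R * th = pi by rewrite -natrM mulrC divfK // lt0r_neq0.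
have Lth : th <= L%:R * th by rewrite ler_peMl // ltW.
have s2 : 0 < sin (2 * th).
  by apply: sin_gt0_pi; rewrite -thE; apply/andP; split; lra.
set nu : R := j.*2.+1%:R.
set a := (nu + 2) * th / 2; set b := (nu - 2) * th / 2.
have := sin_hump_hat nu L0; rewrite -/th -/a -/b.
set c := cos (nu * (pi / 4)) => E.
have c2 : 0 < c ^+ 2 by rewrite cos_odd_quarter_sqr; lra.
have P0 := wave_power_ge0 R (4 * L) j.
have E2 : (sin a * sin b) * (hump_hat L nu * c) = - (c ^+ 2 * sin (2 * th) / 2).
  move: E; set h := hump_hat _ _; set sa := sin a; set sb := sin b => E.
  transitivity (2 * (sa * sb) * h * c / 2); first by field.
  by rewrite E; field.
have {E}cs : 0 < c ^+ 2 * sin (2 * th) / 2 by have := mulr_gt0 c2 s2; lra.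
have nuE : nu = 2 * j%:R + 1 by rewrite /nu -natr1 -mul2n natrM.
rewrite /kernel_coef -/nu -mulrA.
case: ifP => [jE|/negbT/norP[j0 jH]]; last first.
  have jl : 1 <= j%:R :> R by rewrite ler1n; lia.
  have jr : j%:R + 2 <= 4 * L%:R :> R by rewrite -natrM -natrD ler_nat; lia.
  have jlth : th <= j%:R * th by rewrite ler_peMl // ltW.
  have jrth : (j%:R + 2) * th <= 4 * L%:R * th by rewrite ler_pM2r.
  have sa : 0 < sin a.
    by apply: sin_gt0_pi; rewrite -thE /a nuE; apply/andP; split; lra.
  have sb : 0 < sin b.
    by apply: sin_gt0_pi; rewrite -thE /b nuE; apply/andP; split; lra.
  rewrite mulr_ge0_le0 // -(pmulr_rle0 _ (mulr_gt0 sa sb)) E2; lra.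
suff sab : sin a * sin b < 0.
  by rewrite mulr_ge0 // -(nmulr_rle0 _ sab) E2; lra.
case/orP: jE => /eqP jE.
  have sa : 0 < sin a.
    by apply: sin_gt0_pi; rewrite -thE /a nuE jE; apply/andP; split; lra.
  have sb : 0 < sin (- b).
    by apply: sin_gt0_pi; rewrite -thE /b nuE jE; apply/andP; split; lra.
  by rewrite pmulr_rlt0 // -oppr_gt0 -sinN.
have jR : j%:R = 4 * L%:R - 1 :> R.
  by rewrite jE -subn1 natrB ?natrM //; lia.
have sa : 0 < sin (a - pi).
  by apply: sin_gt0_pi; rewrite -thE /a nuE jR; apply/andP; split; lra.
have sb : 0 < sin b.
  by apply: sin_gt0_pi; rewrite -thE /b nuE jR; apply/andP; split; lra.
rewrite pmulr_llt0 // -oppr_gt0; move: sa.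
by rewrite sinB cospi sinpi mulr0 subr0 mulrN1.
Qed.

Definition sign_bounded (R : realType) (m n : nat) (a : 'M[R]_(m, n)) (B : R) :
    Prop :=
  forall (e : 'I_m -> R) (f : 'I_n -> R),
    (forall i, `|e i| = 1) -> (forall j, `|f j| = 1) ->
    \sum_(i < m) \sum_(j < n) a i j * e i * f j <= B.

Definition grid_sum (R : realType) (m n L : nat) (a : 'M[R]_(m, n))
    (x : 'I_m -> nat) (y : 'I_n -> nat) : R :=
  \sum_(i < m) \sum_(j < n)
    a i j * cos (pi / (4 * L)%:R * ((x i)%:R - (y j)%:R)).

(** Multiplying the frequency amounts to moving to other grid points, so a bound
    for all grid points covers all frequencies. *)
Lemma grid_sum_scale (R : realType) (m n L c : nat) (a : 'M[R]_(m, n))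
    (x : 'I_m -> nat) (y : 'I_n -> nat) :
  grid_sum L a (fun i => c * x i)%N (fun j => c * y j)%N =
  \sum_(i < m) \sum_(j < n)
    a i j * cos (c%:R * (pi / (4 * L)%:R) * ((x i)%:R - (y j)%:R)).
Proof.
apply: eq_bigr => i _; apply: eq_bigr => j _.
by rewrite !natrM -mulrBr mulrCA mulrA.
Qed.

Lemma grid_sum_shift (R : realType) (m n L : nat) (a : 'M[R]_(m, n))
    (x : 'I_m -> nat) (y : 'I_n -> nat) : (0 < L)%N ->
  grid_sum L a (fun i => x i + 4 * L)%N y = - grid_sum L a x y.
Proof.
move=> L0; rewrite /grid_sum -sumrN; apply: eq_bigr => i _.
rewrite -sumrN; apply: eq_bigr => j _.
rewrite natrD addrAC -[pi / _]mul1r (_ : 1 = 0.*2.+1%:R) //.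
by rewrite cos_oddD_half ?mulrN //; lia.
Qed.

(** Each product of signs contributes at most [B]; the kernel has total weight
    4 L times the sum of the hump. *)
Lemma sum_kernel_le (R : realType) (m n L : nat) (a : 'M[R]_(m, n)) (B : R)
    (x : 'I_m -> nat) (y : 'I_n -> nat) :
  sign_bounded a B ->
  \sum_(i < m) \sum_(j < n) a i j * kernel R L (x i) (y j) <=
  (\sum_(k < (2 * L).+1) hump R L k) * ((4 * L)%:R * B).
Proof.
move=> hB; rewrite mulr_suml.
have -> : \sum_(i < m) \sum_(j < n) a i j * kernel R L (x i) (y j) =
  \sum_(k < (2 * L).+1) hump R L k * \sum_(t < 4 * L)
    \sum_(i < m) \sum_(j < n)
     a i j * square_wave R (4 * L) (x i + L + t) * square_wave R (4 * L) (y j + k + t).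
  under eq_bigr => i _.
    under eq_bigr => j _ do rewrite /kernel mulr_sumr.
    rewrite exchange_big /=; over.
  rewrite exchange_big /=; apply: eq_bigr => k _.
  rewrite [in RHS]exchange_big mulr_sumr /=; apply: eq_bigr => i _.
  rewrite [in RHS]exchange_big mulr_sumr /=; apply: eq_bigr => j _.
  rewrite /wave_corr mulrCA; congr (_ * _).
  by rewrite mulr_sumr; apply: eq_bigr => t _; rewrite mulrA.
apply: ler_sum => k _; apply: ler_wpM2l; first by apply: hump_ge0; rewrite -ltnS.
rewrite mulr_natl -[in leRHS](card_ord (4 * L)) -sumr_const.
by apply: ler_sum => t _; apply: hB => i; rewrite square_wave_norm.
Qed.

(** * The constant sqrt 2 on a grid *)

(** Contribution to 4 L times the kernel at distance pi/4 of the two frequencies that carry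
    the cosine to be bounded, and, in [inner_mass], of all others. *)
Definition end_mass (R : realType) (L : nat) : R :=
  \sum_(j < 4 * L | first_freq L j)
    kernel_coef R L j * cos (j.*2.+1%:R * (pi / 4)).

Definition inner_mass (R : realType) (L : nat) : R :=
  \sum_(j < 4 * L | ~~ (first_freq L j))
    kernel_coef R L j * cos (j.*2.+1%:R * (pi / 4)).

Lemma inner_mass_le0 (R : realType) (L : nat) : (0 < L)%N -> inner_mass R L <= 0.
Proof.
move=> L0; rewrite -oppr_ge0 -sumrN; apply: sumr_ge0 => j /negbTE jE.
by have := kernel_coef_sign R L0 (ltn_ord j); rewrite jE oppr_ge0.
Qed.

Lemma end_inner_mass (R : realType) (L : nat) : (0 < L)%N ->
  end_mass R L + inner_mass R L =
  (4 * L)%:R * ((2 * L)%:R * \sum_(k < (2 * L).+1) hump R L k).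
Proof.
move=> L0; rewrite -(kernel_quarter R 0 L0) kernel_fourier //.
rewrite [RHS](bigID (fun j : 'I__ => first_freq L j)) /=.
have L0' : L%:R != 0 :> R by rewrite pnatr_eq0 -lt0n.
by congr (_ + _); apply: eq_bigr => j _; congr (_ * cos _); rewrite natrM; field.
Qed.

(** Expand the kernel sum of [sum_kernel_le] in frequencies. The two end frequencies
    both reproduce the given sum. For any other one the coefficient, multiplied by
    cos (n pi/4), is nonpositive, so replacing its sum by the bound [M] with the
    worst sign only decreases the expression. *)
Lemma grid_sum_step (R : realType) (m n L : nat) (a : 'M[R]_(m, n)) (B M : R)
    (x : 'I_m -> nat) (y : 'I_n -> nat) : (0 < L)%N ->
  sign_bounded a B ->
  (forall x y, grid_sum L a x y <= M) ->
  Num.sqrt 2 * (end_mass R L * grid_sum L a x y + inner_mass R L * M) <=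
  (4 * L)%:R * ((\sum_(k < (2 * L).+1) hump R L k) * ((4 * L)%:R * B)).
Proof.
move=> L0 hB hM; have H0 : (0 < 4 * L)%N by lia.
have absM x' y' : `|grid_sum L a x' y'| <= M.
  by rewrite ler_norml hM lerNl -grid_sum_shift // hM.
have H0R : 0 <= (4 * L)%:R :> R by rewrite ler0n.
apply: le_trans (ler_wpM2l H0R (sum_kernel_le L x y hB)).
pose C (j : nat) := grid_sum L a (fun i => j.*2.+1 * x i)%N (fun i => j.*2.+1 * y i)%N.
have -> : (4 * L)%:R * (\sum_(i < m) \sum_(j < n) a i j * kernel R L (x i) (y j)) =
  \sum_(j < 4 * L) kernel_coef R L j * C j.
  rewrite mulr_sumr; under eq_bigr => i _.
    rewrite mulr_sumr; under eq_bigr => l _ do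
      rewrite mulrCA kernel_fourier // mulr_sumr.
    rewrite exchange_big; over.
  rewrite exchange_big; apply: eq_bigr => j _ /=.
  rewrite /C grid_sum_scale mulr_sumr; apply: eq_bigr => i _.
  by rewrite mulr_sumr; apply: eq_bigr => l _; rewrite mulrCA.
have r2 : Num.sqrt 2 ^+ 2 = 2 :> R by rewrite sqr_sqrtr.
rewrite [leRHS](bigID (fun j : 'I__ => first_freq L j)) /=.
rewrite mulrDr lerD //.
  rewrite mulrCA mulr_suml; apply: ler_sum => j jE.
  rewrite (cos_end_quarter R L0 jE) -mulrA le_eqVlt; apply/orP; left; apply/eqP.
  congr (_ * _); transitivity (Num.sqrt 2 ^+ 2 / 2 * grid_sum L a x y); first by ring.
  rewrite r2 divff ?pnatr_eq0 // mul1r.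
  rewrite /C grid_sum_scale; apply: eq_bigr => i _; apply: eq_bigr => l _.
  congr (_ * _); case/orP: jE => /eqP->; first by rewrite mul1r.
  by rewrite cos_top_freq.
rewrite mulrCA mulr_suml; apply: ler_sum => j /negbTE jE.
have := kernel_coef_sign R L0 (ltn_ord j); rewrite jE.
have := cos_odd_quarter_sqr R j; have := norm_cos_odd_quarter R j.
set c := cos _; set k := kernel_coef _ _ _ => nc c2 kc.
have -> : k * C j = (k * c) * (2 * c * C j).
  transitivity (k * C j * (2 * c ^+ 2)); last by ring.
  by rewrite c2; field.
apply: ler_wnM2l => //; apply: le_trans (ler_norm _) _.
rewrite !normrM nc ger0_norm // (_ : 2 * (_ / 2) = Num.sqrt 2); last by field.
by apply: ler_wpM2l (absM _ _); rewrite sqrtr_ge0.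
Qed.

(** With M the supremum, [grid_sum_step] holds for every sum, hence for M itself,
    where the two masses add up to the value of the kernel at pi/4, half of its
    total weight, up to the factor 4 L. *)
Lemma grid_sum_le (R : realType) (m n L : nat) (a : 'M[R]_(m, n)) (B : R)
    (x : 'I_m -> nat) (y : 'I_n -> nat) : (0 < L)%N ->
  sign_bounded a B ->
  grid_sum L a x y <= Num.sqrt 2 * B.
Proof.
move=> L0 hB.
pose S := [set r | exists x y, r = grid_sum L a x y]%classic.
have ubS : has_ubound S.
  exists (\sum_(i < m) \sum_(j < n) `|a i j|) => _ [x' [y' ->]].
  apply: ler_sum => i _; apply: ler_sum => j _.
  apply: le_trans (ler_norm _) _; rewrite normrM -[leRHS]mulr1.
  by rewrite ler_wpM2l ?cos_max.
have hM x' y' : grid_sum L a x' y' <= sup S by apply: ub_le_sup => //; exists x', y'.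
apply: le_trans (hM x y) _.
have W0 := sum_hump_gt0 R L0.
have mass := end_inner_mass R L0; have N0 := inner_mass_le0 R L0.
have step x' y' := grid_sum_step x' y' L0 hB hM.
move: W0 mass N0 step; set W := \sum_(k < _) _; set E := end_mass R L.
set N := inner_mass R L; set M := sup S => W0 mass N0 step.
have L1 : 0 < L%:R :> R by rewrite ltr0n.
have T0 : 0 < (4 * L)%:R * ((2 * L)%:R * W) by rewrite !mulr_gt0 // natrM mulr_gt0.
have E0 : 0 < E by rewrite -mass in T0; lra.
have r0 : 0 < Num.sqrt 2 :> R by rewrite sqrtr_gt0.
have r2 : Num.sqrt 2 ^+ 2 = 2 :> R by rewrite sqr_sqrtr.
move: r0 r2 step; set r : R := Num.sqrt 2 => r0 r2 step.
set U := (4 * L)%:R * (W * _) in step.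
have : M <= (U / r - N * M) / E.
  apply: ge_sup; first by exists (grid_sum L a x y), x, y.
  move=> _ [x' [y' ->]]; rewrite ler_pdivlMr // lerBrDr ler_pdivlMr //.
  by rewrite mulrC (mulrC _ E); apply: step.
rewrite ler_pdivlMr // lerBrDr ler_pdivlMr // => main.
have : (4 * L)%:R * ((2 * L)%:R * W) * (r * M) <= (4 * L)%:R * ((2 * L)%:R * W) * (2 * B).
  rewrite -mass; have -> : (E + N) * (r * M) = (M * E + N * M) * r by ring.
  apply: le_trans main _; rewrite mass /U !natrM le_eqVlt; apply/orP; left.
  by apply/eqP; ring.
rewrite ler_pM2l // -r2 expr2 -mulrA ler_pM2l //.
Qed.

(** * Arbitrary angles *)

Lemma cos_lipschitz (R : realType) (x y : R) : `|cos x - cos y| <= `|x - y|.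
Proof.
wlog le_yx : x y / y <= x => [W|].
  by case: (leP y x) => [/W//|/ltW/W]; rewrite distrC [in leRHS]distrC.
have dcos z : z \in `]y, x[%R -> is_derive z 1 cos (- sin z).
  by move=> _; apply: is_derive_cos.
have ccos : {within `[y, x]%classic, continuous (@cos R)}%classic.
  by apply: continuous_subspaceT => z; apply: continuous_cos.
have [z _ ->] := MVT_segment le_yx dcos ccos.
by rewrite normrM normrN ler_piMl // sin_max.
Qed.

Lemma unit_vector_angle (R : realType) (x y : R) : x ^+ 2 + y ^+ 2 = 1 ->
  exists2 t, 0 <= t & x = cos t /\ y = sin t.
Proof.
move=> xy1; have x1 : -1 <= x <= 1 by apply/andP; split; nra.
have sE : sin (acos x) = `|y|.
  by rewrite sin_acos // -xy1 addrC addKr sqrtr_sqr.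
have cE : cos (acos x) = x by apply: acosK; rewrite in_itv.
have [y0|y0] := leP 0 y.
  by exists (acos x); rewrite ?acos_ge0 // cE sE ger0_norm.
exists (- acos x + pi *+ 2).
  by have := acos_lepi x1; have := pi_ge0 R; rewrite -mulr_natr; lra.
by rewrite cosD2pi sinD2pi cosN sinN cE sE ltr0_norm // opprK.
Qed.

(** Round all angles down to a grid whose mesh tends to 0. *)
Lemma angle_sum_le (R : realType) (m n : nat) (a : 'M[R]_(m, n)) (B : R)
    (al : 'I_m -> R) (be : 'I_n -> R) :
  (forall i, 0 <= al i) -> (forall j, 0 <= be j) ->
  sign_bounded a B ->
  \sum_(i < m) \sum_(j < n) a i j * cos (al i - be j) <= Num.sqrt 2 * B.
Proof.
move=> al0 be0 hB; apply/ler_addgt0Pr => e e0.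
set A := \sum_(i < m) \sum_(j < n) `|a i j|.
have A0 : 0 <= A by apply: sumr_ge0 => i _; apply: sumr_ge0 => j _.
(* Rounding moves each difference by at most twice the mesh pi / (4 L), so the
   total error is at most A * pi / (2 * L). *)
pose L := (Num.truncn (A * pi / e)).+1; have L0 : (0 < L)%N by [].
have L0' : 0 < L%:R :> R by rewrite ltr0n.
have hL : A * pi / e < L%:R.
  have /truncn_itv/andP[] // : 0 <= A * pi / e.
  by rewrite divr_ge0 ?mulr_ge0 ?pi_ge0 // ltW.
set th : R := pi / (4 * L)%:R.
have th0 : 0 < th by rewrite divr_gt0 ?pi_gt0 // ltr0n.
pose x t := Num.truncn (t / th).
have hx t : 0 <= t -> `|t - th * (x t)%:R| <= th.
  move=> t0; have /truncn_itv : 0 <= t / th by rewrite divr_ge0 // ltW.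
  rewrite ler_pdivlMr // ltr_pdivrMr // -/(x t) -natr1 => /andP[lo hi].
  by rewrite ger0_norm; lra.
apply: le_trans (lerD (grid_sum_le (x \o al) (x \o be) L0 hB) (lexx e)).
rewrite -lerBlDl; apply: (@le_trans _ _ (A * (2 * th))).
  rewrite /grid_sum -sumrB mulr_suml; apply: ler_sum => i _.
  rewrite -sumrB mulr_suml; apply: ler_sum => j _.
  rewrite -mulrBr; apply: le_trans (ler_norm _) _; rewrite normrM.
  rewrite ler_wpM2l //; apply: le_trans (cos_lipschitz _ _) _.
  rewrite -/th (_ : _ - _ = (al i - th * (x (al i))%:R) - (be j - th * (x (be j))%:R)).
    by apply: le_trans (ler_normB _ _) _; rewrite mulr2n mulrDl mul1r lerD // hx.
  by rewrite /=; ring.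
rewrite /th (_ : _ * _ = (A * pi / L%:R) / 2); last first.
  by rewrite natrM; field; rewrite lt0r_neq0.
have : A * pi / L%:R <= e.
  by rewrite ler_pdivrMr // -ler_pdivrMl // mulrC ltW.
lra.
Qed.

(** * Complex unimodular values of real and complex matrices *)

Local Open Scope complex_scope.

Lemma ReD (R : realType) (x y : R[i]) : complex.Re (x + y) = complex.Re x + complex.Re y.
Proof. by case: x; case: y. Qed.

Lemma Re_sum (R : realType) (I : finType) (F : I -> R[i]) :
  complex.Re (\sum_i F i) = \sum_i complex.Re (F i).
Proof. by apply: (big_morph _ (@ReD R)). Qed.

Lemma Re_realM (R : realType) (r : R) (z : R[i]) : complex.Re (r%:C * z) = r * complex.Re z.
Proof. by case: z => a b /=; rewrite mul0r subr0. Qed.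

Lemma norm_Re_le (R : realType) (z : R[i]) : `|complex.Re z| <= normc z.
Proof.
case: z => a b /=; rewrite -sqrtr_sqr ler_wsqrtr // lerDl; exact: sqr_ge0.
Qed.

Lemma normc_sqr (R : realType) (x y : R) : normc (x +i* y) ^+ 2 = x ^+ 2 + y ^+ 2.
Proof. by rewrite sqr_sqrtr ?addr_ge0 ?sqr_ge0. Qed.

Lemma normc_ge0 (R : realType) (z : R[i]) : 0 <= normc z.
Proof. by case: z => a b; apply: sqrtr_ge0. Qed.

Lemma normc_real (R : realType) (r : R) : normc r%:C = `|r|.
Proof. by rewrite /= expr0n addr0 sqrtr_sqr. Qed.

Lemma normc_conj (R : realType) (z : R[i]) : normc z^* = normc z.
Proof. by case: z => x y /=; rewrite sqrrN. Qed.

Lemma abs_sum_le (R : realType) (F : nmodType) (abs : F -> R) (k : nat)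
    (G : 'I_k -> F) :
  abs 0 = 0 -> (forall x y, abs (x + y) <= abs x + abs y) ->
  abs (\sum_i G i) <= \sum_i abs (G i).
Proof.
move=> abs0 absD; elim/big_ind2 : _ => [|x x' y y' lx ly|//]; first by rewrite abs0.
by apply: le_trans (absD _ _) _; apply: lerD.
Qed.

(** Stated for an abstract modulus because it serves both scalar fields. *)
Lemma unimodular_values_ub (R : realType) (F : nzRingType) (abs : F -> R) (m n : nat)
    (a : 'M[F]_(m, n)) :
  abs 0 = 0 -> (forall x y, abs (x + y) <= abs x + abs y) ->
  (forall x y, abs (x * y) = abs x * abs y) ->
  has_ubound (unimodular_values abs a).
Proof.
move=> abs0 absD absM.
exists (\sum_(i < m) \sum_(j < n) abs (a i j)) => _ [p [q [hp hq ->]]].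
apply: le_trans (abs_sum_le _ abs0 absD) _; apply: ler_sum => i _.
apply: le_trans (abs_sum_le _ abs0 absD) _; apply: ler_sum => j _.
by rewrite !absM hp hq !mulr1.
Qed.

(** Multiplication by the conjugate phase. *)
Lemma rotation_to_real (R : realType) (z : R[i]) :
  exists2 w : R[i], normc w = 1 & complex.Re (w * z) = normc z.
Proof.
have [->|z0] := eqVneq z 0.
  by exists 1; rewrite ?normc1 // mulr0 normc0.
have n0 : normc z != 0 by apply: contra_neq z0 => /eq0_normc.
exists ((normc z)^-1%:C * z^*).
  by rewrite normcM normc_real normc_conj ger0_norm ?invr_ge0 ?normc_ge0 // mulVf.
rewrite -mulrA Re_realM; case: z z0 n0 => x y _ n0.
rewrite (_ : complex.Re _ = normc (x +i* y) ^+ 2); last by rewrite normc_sqr /=; ring.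
by rewrite expr2 mulKf.
Qed.

(** Absorbing a phase into [p] makes the sum real; its terms are then
    a_ij cos (al_i - be_j), with al_i the argument of the rotated p_i and be_j that
    of the conjugate of q_j. *)
Lemma complexified_value_le (R : realType) (m n : nat) (a : 'M[R]_(m, n))
    (p : 'I_m -> R[i]) (q : 'I_n -> R[i]) :
  (forall i, normc (p i) = 1) -> (forall j, normc (q j) = 1) ->
  normc (\sum_(i < m) \sum_(j < n) (a i j)%:C * p i * q j) <=
  Num.sqrt 2 * sup (unimodular_values (fun x : R => `|x|) a).
Proof.
move=> hp hq; set S := \sum_(i < m) _.
have [w w1 <-] := rotation_to_real S.
have wp i : (complex.Re (w * p i)) ^+ 2 + (complex.Im (w * p i)) ^+ 2 = 1.
  have : normc (w * p i) ^+ 2 = 1 by rewrite normcM w1 hp mul1r expr1n.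
  by case: (w * p i) => x y; rewrite normc_sqr.
have cq j : (complex.Re (q j)) ^+ 2 + (- complex.Im (q j)) ^+ 2 = 1.
  have : normc (q j) ^+ 2 = 1 by rewrite hq expr1n.
  by case: (q j) => x y; rewrite normc_sqr sqrrN.
have al i : {t : R | 0 <= t & complex.Re (w * p i) = cos t /\ complex.Im (w * p i) = sin t}.
  by apply/boolp.cid2/unit_vector_angle.
have be j : {t : R | 0 <= t & complex.Re (q j) = cos t /\ - complex.Im (q j) = sin t}.
  by apply/boolp.cid2/unit_vector_angle.
rewrite (_ : complex.Re _ =
  \sum_(i < m) \sum_(j < n) a i j * cos (s2val (al i) - s2val (be j))).
  apply: angle_sum_le => [i|j|e f he hf].
  - by case: (al i).
  - by case: (be j).
  apply: le_trans (ler_norm _) _; apply: ub_le_sup; last by exists e, f.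
  apply: unimodular_values_ub; [exact: normr0|exact: ler_normD|exact: normrM].
rewrite mulr_sumr Re_sum; apply: eq_bigr => i _.
rewrite mulr_sumr Re_sum; apply: eq_bigr => j _.
rewrite (_ : w * _ = (a i j)%:C * ((w * p i) * q j)); last by ring.
rewrite Re_realM; congr (_ * _).
case: (al i) => s _ [/= cs ss]; case: (be j) => t _ [/= ct st].
rewrite cosB -cs -ss -ct -st; case: (w * p i) => x y; case: (q j) => x' y' /=.
by ring.
Qed.

(** * Transfer between the real and the complex constant *)

Definition complexify (R : realType) (d : nat) (x : 'rV[R]_(d + d)) : 'rV[R[i]]_d :=
  \row_k (x 0 (lshift d k) +i* x 0 (rshift d k)).

Lemma enorm_complexify (R : realType) (d : nat) (x : 'rV[R]_(d + d)) :
  enorm (@normc R) (complexify x) = enorm (fun z : R => `|z|) x.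
Proof.
rewrite /enorm big_split_ord /= -big_split /=; congr Num.sqrt.
by apply: eq_bigr => k _; rewrite mxE normc_sqr !real_normK ?num_real.
Qed.

Lemma inner_complexify (R : realType) (d : nat) (x y : 'rV[R]_(d + d)) :
  complex.Re (inner conjc (complexify x) (complexify y)) = inner id x y.
Proof.
rewrite /inner big_split_ord /= -big_split Re_sum /=.
by apply: eq_bigr => k _; rewrite !mxE /=; ring.
Qed.

Lemma complex_bound_to_real (R : realType) (d : nat) (K : R) :
  grothendieck_bound (@conjc R) (@normc R) d K ->
  grothendieck_bound id (fun x : R => `|x|) (d + d) (Num.sqrt 2 * K).
Proof.
move=> [K0 hK]; split; first by rewrite mulr_gt0 // sqrtr_gt0.
move=> m n m0 n0 a u v hu hv.
have := hK m n m0 n0 (map_mx (real_complex R) a) (fun i => complexify (u i)) (fun j => complexify (v j)).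
have hU i : enorm (@normc R) (complexify (u i)) = 1 by rewrite enorm_complexify hu.
have hV i : enorm (@normc R) (complexify (v i)) = 1 by rewrite enorm_complexify hv.
move=> /(_ hU hV); set S := \sum_(i < m) _; set s := sup _ => le_S.
have -> : \sum_(i < m) \sum_(j < n) a i j * inner id (u i) (v j) = complex.Re S.
  rewrite Re_sum; apply: eq_bigr => i _; rewrite Re_sum; apply: eq_bigr => j _.
  by rewrite mxE Re_realM inner_complexify.
apply: le_trans (norm_Re_le _) _; apply: le_trans le_S _.
rewrite mulrAC mulrC ler_pM2r //; apply: ge_sup.
  by eexists; exists (fun=> 1), (fun=> 1); split=> // *; rewrite normc1.
move=> _ [p [q [hp hq ->]]].
rewrite (eq_bigr (fun i => \sum_(j < n) (a i j)%:C * p i * q j)).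
  exact: complexified_value_le.
by move=> i _; apply: eq_bigr => j _; rewrite mxE.
Qed.

(** The chord through [z] orthogonal to [z] meets the unit circle in two points with
    midpoint [z]; for [z] = 0 any diameter will do. *)
Lemma disc_average (R : realType) (z : R[i]) : normc z <= 1 ->
  exists z1 z2, [/\ normc z1 = 1, normc z2 = 1 & z + z = z1 + z2].
Proof.
case: z => x y hz.
have hz2 : x ^+ 2 + y ^+ 2 <= 1.
  by rewrite -normc_sqr -[leRHS](expr1n _ 2) lerXn2r // ?nnegrE ?normc_ge0.
have unit u v : u ^+ 2 + v ^+ 2 = 1 -> normc (u +i* v) = 1.
  by move=> uv1; rewrite /= uv1 sqrtr1.
have [r0|r0] := eqVneq (x ^+ 2 + y ^+ 2) 0.
  have [x0 y0] : x = 0 /\ y = 0.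
    move/eqP: r0; rewrite paddr_eq0 ?sqr_ge0 // !sqrf_eq0.
    by move=> /andP[/eqP -> /eqP ->].
  exists (1 +i* 0), (-1 +i* 0); split; try by apply: unit; ring.
  by rewrite x0 y0; apply/eqP; rewrite eq_complex /=; apply/andP; split; apply/eqP; ring.
have rp : 0 < x ^+ 2 + y ^+ 2 by rewrite lt_def r0 addr_ge0 ?sqr_ge0.
pose t := Num.sqrt ((x ^+ 2 + y ^+ 2)^-1 - 1).
have t2 : t ^+ 2 = (x ^+ 2 + y ^+ 2)^-1 - 1.
  by rewrite sqr_sqrtr // subr_ge0 invf_ge1.
have E : (x ^+ 2 + y ^+ 2) * (1 + t ^+ 2) = 1 by rewrite t2 (addrC 1) subrK mulfV.
exists ((x - t * y) +i* (y + t * x)), ((x + t * y) +i* (y - t * x)); split.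
- by apply: unit; rewrite -E; ring.
- by apply: unit; rewrite -E; ring.
by apply/eqP; rewrite eq_complex /=; apply/andP; split; apply/eqP; ring.
Qed.

(** The sum is affine in each coordinate, and each point of the disc is a midpoint of
    unimodular ones; replacing all coordinates at once writes the sum as a mean of
    two unimodular sums. *)
Lemma disc_sum_le (R : realType) (m : nat) (c p : 'I_m -> R[i]) (s : R) :
  (forall p', (forall i, normc (p' i) = 1) -> normc (\sum_(i < m) p' i * c i) <= s) ->
  (forall i, normc (p i) <= 1) -> normc (\sum_(i < m) p i * c i) <= s.
Proof.
move=> hs hp.
have pick i : {z : R[i] * R[i] | [/\ normc z.1 = 1, normc z.2 = 1 & p i + p i = z.1 + z.2]}.
  by apply: boolp.cid; have [z1 [z2 h]] := disc_average (hp i); exists (z1, z2).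
set S := \sum_(i < m) _.
have S2 : S + S = \sum_(i < m) (sval (pick i)).1 * c i + \sum_(i < m) (sval (pick i)).2 * c i.
  rewrite -!big_split; apply: eq_bigr => i _ /=; rewrite -!mulrDl.
  by case: (pick i) => z [/= _ _ ->].
have : normc (S + S) <= s + s.
  rewrite S2; apply: le_trans (le_normcD _ _) _.
  by apply: lerD; apply: hs => i; case: (pick i) => z [].
rewrite -mulr2n normcMn; lra.
Qed.

Lemma norm_coord_le1 (R : realType) (d : nat) (x : 'rV[R[i]]_d) (k : 'I_d) :
  enorm (@normc R) x = 1 -> normc (x 0 k) <= 1.
Proof.
move=> hx; have : normc (x 0 k) ^+ 2 <= 1.
  rewrite -(expr1n _ 2) -hx /enorm sqr_sqrtr; last first.
    by apply: sumr_ge0 => i _; apply: sqr_ge0.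
  rewrite (bigD1 k) //= lerDl; apply: sumr_ge0 => i _; exact: sqr_ge0.
by move=> h; rewrite -(@ler_pXn2r _ 2) ?nnegrE ?normc_ge0 // expr1n.
Qed.

(** Split the inner products into their [d] coordinates, each of which lies in the
    unit disc, where [disc_sum_le] applies to rows and columns in turn. *)
Lemma complex_bound_exists (R : realType) (d : nat) : (0 < d)%N ->
  grothendieck_bound (@conjc R) (@normc R) d d%:R.
Proof.
move=> d0; split; first by rewrite ltr0n.
move=> m n _ _ a u v hu hv; set s := sup _.
have le_s p q : (forall i, normc (p i) = 1) -> (forall j, normc (q j) = 1) ->
    normc (\sum_(i < m) \sum_(j < n) a i j * p i * q j) <= s.
  move=> hp hq; apply: ub_le_sup; last by exists p, q.
  apply: unimodular_values_ub; [exact: normc0|exact: le_normcD|exact: normcM].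
have disc_s p q : (forall i, normc (p i) <= 1) -> (forall j, normc (q j) <= 1) ->
    normc (\sum_(i < m) \sum_(j < n) a i j * p i * q j) <= s.
  move=> hp hq.
  have rowE p' q' : \sum_(i < m) \sum_(j < n) a i j * p' i * q' j =
      \sum_(i < m) p' i * \sum_(j < n) a i j * q' j.
    apply: eq_bigr => i _; rewrite mulr_sumr.
    by apply: eq_bigr => j _; rewrite mulrA (mulrC (p' i)).
  have colE p' q' : \sum_(i < m) \sum_(j < n) a i j * p' i * q' j =
      \sum_(j < n) q' j * \sum_(i < m) a i j * p' i.
    rewrite exchange_big; apply: eq_bigr => j _; rewrite mulr_sumr.
    by apply: eq_bigr => i _; rewrite mulrC.
  rewrite rowE; apply: disc_sum_le => // p' hp'.
  rewrite -rowE colE; apply: disc_sum_le => // q' hq'.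
  by rewrite -colE; apply: le_s.
have -> : \sum_(i < m) \sum_(j < n) a i j * inner conjc (u i) (v j) =
    \sum_(k < d) \sum_(i < m) \sum_(j < n) a i j * u i 0 k * (v j 0 k)^*.
  rewrite [RHS]exchange_big /=; apply: eq_bigr => i _.
  rewrite [RHS]exchange_big /=; apply: eq_bigr => j _.
  by rewrite /inner mulr_sumr; apply: eq_bigr => k _; rewrite mulrA.
apply: le_trans (abs_sum_le _ (@normc0 R) (@le_normcD R)) _.
rewrite mulr_natl -[in leRHS](card_ord d) -sumr_const; apply: ler_sum => k _.
apply: disc_s => [i|j]; first exact: norm_coord_le1.
by rewrite normc_conj; apply: norm_coord_le1.
Qed.

Theorem mainTheorem1 (R : realType) (d : nat) (hd : (0 < d)%N) :
  KG_real R (2 * d)%N <= Num.sqrt 2 * KG_complex R d.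
Proof.
have r0 : 0 < Num.sqrt 2 :> R by rewrite sqrtr_gt0.
rewrite mul2n -addnn mulrC -ler_pdivrMr //.
apply: lb_le_inf; first by exists d%:R; apply: complex_bound_exists.
move=> K hK; rewrite ler_pdivrMr // mulrC; apply: ge_inf.
  by exists 0 => K' [/ltW].
exact: complex_bound_to_real.
Qed.
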